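(* For every nonnegative integer $n$ and every positive integer $m$ the following identities hold: (i) $\displaystyle\sum_{k=1}^n \frac{C_kO_k}{2^{2k}} = 2-\frac{C_n}{2^{2n}}\bigl((2n+1)O_n+2n+2\bigr)$; (ii) $\displaystyle\sum_{k=1}^n (-1)^{k-1}2^{2k}\binom{n+1}{k+1}\frac{O_k}{C_k} = \frac{2n(n+1)}{(2n-1)^2}$; (iii) $\displaystyle\sum_{k=1}^n\left(\frac{2^{-2k}C_{n+k}}{\prod_{j=1}^n\bigl(2(n-j+k)+1\bigr)}+\frac{2^{2k}C_{n-k}}{\prod_{j=1}^n\bigl(2(n-j-k)+1\bigr)}\right)O_k = \frac{(-1)^n2^{3n+2}}{(n+2)!}\frac{O_{n+1}}{C_{n+1}}-\frac{2^{-n}O_n}{n!\,(2n+1)}-\frac{2^{1-n}}{n!\,(2n+1)^2}$; (iv) $\displaystyle\sum_{k=0}^\infty 2^{-2k}\frac{C_kO_k}{\binom{k+m}{m-1}} = \frac{1}{m(m+1)}\sum_{k=1}^m(-1)^{k-1}2^{2k}\binom{m+1}{k+1}\frac{O_k}{C_k}$; (v) $\displaystyle\sum_{k=0}^\infty\frac{C_kO_k}{2^{2k}}=2$.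
   Context: $C_n=\frac{1}{n+1}\binom{2n}{n}$, $n\ge 0$, are the Catalan numbers. $O_n=\sum_{k=1}^n\frac{1}{2k-1}$ are the odd harmonic numbers, with $O_0=0$. Empty sums equal $0$ and empty products equal $1$. *)

(* Defs.v *)
From HB Require Import structures.
From mathcomp Require Import all_boot all_order all_algebra.
From mathcomp Require Import all_classical all_reals all_analysis.

Set Implicit Arguments.
Unset Strict Implicit.
Unset Printing Implicit Defensive.

Import Order.TTheory GRing.Theory Num.Theory.
Import numFieldNormedType.Exports.

Local Open Scope ring_scope.

Definition catalan (R : realType) (n : nat) : R :=
  1 / (n%:R + 1) * 'C(2 * n, n)%:R.

Definition odd_harmonic (R : realType) (n : nat) : R :=
  \sum_(1 <= k < n.+1) 1 / (2 * k%:R - 1).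

(* Main.v *)
(** Up to a constant factor every summand is t_k O_k with t hypergeometric of
    ratio t_(k+1) / t_k = (2k+1) / (2(k+x+1)) or 2(k-x) / (2k+1). In both cases
    t_k O_k is a difference F_(k-1) - F_k, where F_k is t_k times an affine
    function of O_k with coefficients rational in k and x, so all the partial
    sums are explicit. Identities (i) and (v) are the first case with x = 1,
    (iv) is the first case with x = m, and (ii) the second case with x = n.
    The left-hand side of (iii) is the sum of one instance of each, both with
    x = n + 1, and their constant terms cancel. The series converge because
    the central binomial weight binom(2n,n) / 4^n is at most (2n+1)^(-1/2) while
    O_n grows at most like (2n+1)^(1/3). *)

Require Import Defs.
From HB Require Import structures.
From mathcomp Require Import all_boot all_order all_algebra.
From mathcomp Require Import all_classical all_reals all_analysis.
From mathcomp Require Import ring lra.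

Set Implicit Arguments.
Unset Strict Implicit.
Unset Printing Implicit Defensive.

Import Order.TTheory GRing.Theory Num.Theory.
Import numFieldNormedType.Exports.

Local Open Scope classical_set_scope.
Local Open Scope ring_scope.

Section CatalanOddHarmonic.
Variable R : realType.
Implicit Types (t : nat -> R) (x : R) (k n m : nat).

Local Notation C := (@catalan R).
Local Notation O := (@odd_harmonic R).

(** * Elementary recurrences for odd harmonic and Catalan numbers *)

Lemma double_natr_add1_neq0 k : 2 * k%:R + 1 != 0 :> R.
Proof. by rewrite -natrM natr1 pnatr_eq0. Qed.

Lemma double_natr_sub1_neq0 k : 2 * k%:R - 1 != 0 :> R.
Proof.
rewrite -natrM subr_eq0 pnatr_eq1; apply/eqP => h.
by have := congr1 odd h; rewrite oddM.
Qed.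

Lemma odd_harmonic0 : O 0 = 0.
Proof. by rewrite /odd_harmonic big_geq. Qed.

Lemma odd_harmonicS n : O n.+1 = O n + 1 / (2 * n%:R + 1).
Proof.
by rewrite /odd_harmonic big_nat_recr //=; congr (_ + 1 / _);
  rewrite -(natr1 n); ring.
Qed.

Lemma odd_harmonic_ge0 n : 0 <= O n.
Proof.
elim: n => [|n IHn]; first by rewrite odd_harmonic0.
by rewrite odd_harmonicS addr_ge0 // divr_ge0 // addr_ge0 // mulr_ge0.
Qed.

Lemma catalan0 : C 0 = 1.
Proof. by rewrite /catalan add0r divr1 mul1r bin0. Qed.

Lemma catalan_gt0 n : 0 < C n.
Proof.
rewrite /catalan mulr_gt0 ?divr_gt0 ?ltr_pwDr //.
by rewrite ltr0n bin_gt0 mul2n -addnn leq_addr.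
Qed.

Lemma catalan_fact n : C n * (n.+1)`!%:R * n`!%:R = (2 * n)`!%:R.
Proof.
have h : (n <= 2 * n)%N by rewrite mul2n -addnn leq_addr.
rewrite -(bin_fact h) /catalan mul2n -addnn addnK factS !natrM -(natr1 n).
by field; rewrite natr1 pnatr_eq0.
Qed.

Lemma catalanS n : C n.+1 = 2 * (2 * n%:R + 1) / (n%:R + 2) * C n.
Proof.
have n2 : n%:R + 2 != 0 :> R by rewrite -natrD pnatr_eq0 addn2.
have n1 : n%:R + 1 != 0 :> R by rewrite natr1 pnatr_eq0.
have f0 : n`!%:R != 0 :> R by rewrite pnatr_eq0 -lt0n fact_gt0.
have := catalan_fact n.+1.
rewrite mulnS !add2n !factS !natrM -[(2 * n).+2]addn2.
rewrite -[(2 * n).+1]addn1 -[n.+2]addn2 -[n.+1]addn1 !natrD ?natrM -catalan_fact.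
rewrite addn1 factS -[n.+1]addn1 natrM natrD.
move: (C n) (C (n + 1)) n`!%:R f0 n1 n2 => c d f f0 n1 n2 h.
have h0 : (n%:R + 2) * ((n%:R + 1) * f) * ((n%:R + 1) * f) != 0 :> R.
  by rewrite !mulf_neq0.
by apply: (mulIf h0); rewrite [LHS]mulrA h; field.
Qed.

(** * Two telescoping sums weighted by [O k] *)

(** With [G k = (2k + 1) t k / (2x - 1)] one has [t k = G (k-1) - G k]. Summation by parts against
    [O] leaves [G (k-1) / (2k - 1) = t (k-1) / (2x - 1)], which telescopes again. *)
Lemma sum_odd_harmonic_rising t x n :
    2 * x - 1 != 0 ->
    (forall k, (k < n)%N ->
      t k.+1 * (2 * (k%:R + x + 1)) = t k * (2 * k%:R + 1)) ->
  \sum_(1 <= k < n.+1) t k * O k =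
    2 * x * t 0 / (2 * x - 1) ^+ 2
    - t n * ((2 * n%:R + 1) * O n / (2 * x - 1)
             + 2 * (n%:R + x) / (2 * x - 1) ^+ 2).
Proof.
move=> x0; elim: n => [|n IHn] ht.
  by rewrite big_geq // odd_harmonic0; field.
rewrite big_nat_recr //= IHn => [|k lt_kn]; last exact/ht/ltnW.
have n0 := double_natr_add1_neq0 n.
(* Solving for [t n] divides by [2n + 1], which never vanishes, whereas [n + x + 1] may. *)
have -> : t n = t n.+1 * (2 * (n%:R + x + 1)) / (2 * n%:R + 1).
  by rewrite ht // mulfK.
by rewrite odd_harmonicS -(natr1 n); field; rewrite x0 n0.
Qed.

(** The same summation by parts with [G k = 2(k - x) t k / (2x - 1)]; now the remaining terms are
    [t k / (2x - 1)]. *)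
Lemma sum_odd_harmonic_falling t x n :
    2 * x - 1 != 0 ->
    (forall k, (k < n)%N ->
      t k.+1 * (2 * k%:R + 1) = t k * (2 * (k%:R - x))) ->
  \sum_(1 <= k < n.+1) t k * O k =
    - (2 * x * t 0 / (2 * x - 1) ^+ 2)
    - t n * (n%:R - x) * (2 * O n / (2 * x - 1) + 2 / (2 * x - 1) ^+ 2).
Proof.
move=> x0; elim: n => [|n IHn] ht.
  by rewrite big_geq // odd_harmonic0; field.
rewrite big_nat_recr //= IHn => [|k lt_kn]; last exact/ht/ltnW.
have n0 := double_natr_add1_neq0 n.
have -> : t n.+1 = t n * (2 * (n%:R - x)) / (2 * n%:R + 1).
  by rewrite -ht // mulfK.
by rewrite odd_harmonicS -(natr1 n); field; rewrite x0 n0.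
Qed.

(** * Growth bounds and null sequences *)

(* The quadratic bound O_n^2 <= 2n+1 bounds the increments of O_n^3. *)
Lemma odd_harmonic_cube_le n : O n ^+ 3 <= 7 * (2 * n%:R + 1).
Proof.
have le_n : O n <= n%:R /\ O n ^+ 2 <= 2 * n%:R + 1 /\
    O n ^+ 3 <= 7 * (2 * n%:R + 1).
  elim: n => [|n [h1 [h2 h3]]]; first by rewrite odd_harmonic0; split; [|split]; lra.
  rewrite odd_harmonicS -(natr1 n); have := odd_harmonic_ge0 n.
  have n0 : 0 <= n%:R :> R by [].
  have : (2 * n%:R + 1) * (1 / (2 * n%:R + 1)) = 1 :> R.
    by rewrite mulrC divfK // double_natr_add1_neq0.
  move: (1 / _) => d hd; move: n0 h1 h2 h3 hd.
  move: (n%:R : R) (O n) => y o y0 h1 h2 h3 hd o0.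
  have d0 : 0 <= d by nra.
  have d1 : d <= 1 by nra.
  (* The linear bound gives [o * d <= 1/2], so the square grows by at most [1 + 1], exactly the
     increment of [2n + 1]. The cube grows by at most [3 + 3 + 1 = 7]. *)
  have od : o * d <= 1 / 2.
    by have := ler_wpM2r d0 h1; lra.
  have dd : d * d <= 1 by have := ler_pM d0 d0 d1 d1; lra.
  have ood : o * o * d <= 1.
    by have := ler_wpM2r d0 h2; rewrite hd expr2.
  have odd_le : o * d * d <= 1 by have := ler_pM (mulr_ge0 o0 d0) d0 od d1; lra.
  have ddd : d * d * d <= 1 by have := ler_pM (mulr_ge0 d0 d0) d0 dd d1; lra.
  rewrite !expr2 !exprS !expr0 in h2 h3 *; split; [|split]; lra.
by case: le_n => _ [].
Qed.

(* This is binom(2n, n) / 4 ^ n. *)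
Definition central_weight n : R := (n%:R + 1) * C n / 2 ^+ (2 * n).

Lemma centralS n :
  central_weight n.+1 = central_weight n * ((2 * n%:R + 1) / (2 * n%:R + 2)).
Proof.
have n2 : n%:R + 2 != 0 :> R by rewrite -natrD pnatr_eq0 addn2.
have n1 : n%:R + 1 != 0 :> R by rewrite natr1 pnatr_eq0.
rewrite /central_weight catalanS mulnS exprD -(natr1 n); field.
rewrite n2 expf_neq0 //= andbT.
by have -> : 2 * n%:R + 2 = 2 * (n%:R + 1) :> R by [ring]; rewrite mulf_neq0.
Qed.

Lemma central_gt0 n : 0 < central_weight n.
Proof.
by rewrite /central_weight divr_gt0 ?exprn_gt0 // mulr_gt0 ?catalan_gt0 // natr1 ltr0n.
Qed.

(** The left-hand side is 1 at [n = 0] and does not increase, because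
    [(2n + 1)(2n + 3) <= (2n + 2)^2]. *)
Lemma central_sqr_le n : central_weight n ^+ 2 * (2 * n%:R + 1) <= 1.
Proof.
elim: n => [|n IHn]; first by rewrite /central_weight catalan0 muln0 expr0; lra.
rewrite centralS -(natr1 n) exprMn; apply: le_trans IHn.
rewrite -mulrA ler_wpM2l ?sqr_ge0 // expr_div_n mulrAC ler_pdivrMr.
  by have n0 : 0 <= n%:R :> R by []; nra.
by rewrite exprn_gt0 // ltr_wpDl // mulr_ge0.
Qed.

(** If [u n >= e > 0], then [2n + 1 <= K / e^j], which fails for large [n]. Integer powers here
    replace fractional exponents. *)
Lemma cvg_of_pow_le (u : R^nat) (K : R) j :
    (forall n, 0 <= u n) -> (forall n, u n ^+ j * (2 * n%:R + 1) <= K) ->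
  u @ \oo --> (0 : R).
Proof.
move=> u0 uK; apply/cvgrPdist_lt => e e0; near=> n.
rewrite sub0r normrN ger0_norm // ltNge; apply/negP => le_eu.
have ej : 0 < e ^+ j by rewrite exprn_gt0.
have : e ^+ j * (2 * n%:R + 1) <= K.
  by apply: le_trans (uK n); rewrite ler_wpM2r // ?lerXn2r ?nnegrE ?(ltW e0).
apply/negP; rewrite -ltNge mulrC -ltr_pdivrMr //.
have : K / e ^+ j < n%:R by near: n; exact: nbhs_infty_gtr.
by have n0 : 0 <= n%:R :> R by []; lra.
Unshelve. all: by end_near. Qed.

Lemma cvg_central : central_weight n @[n --> \oo] --> (0 : R).
Proof.
by apply: (@cvg_of_pow_le _ 1 2) => n; [exact/ltW/central_gt0|exact: central_sqr_le].
Qed.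

Lemma cvg_central_odd_harmonic : central_weight n * O n @[n --> \oo] --> (0 : R).
Proof.
(* The sixth power serves both bounds: the weight contributes at most [(2n + 1)^-3] and [O n] at
   most [49 (2n + 1)^2], leaving one factor [2n + 1] to spare. *)
apply: (@cvg_of_pow_le _ (7 ^+ 2) 6) => n.
  by rewrite mulr_ge0 ?odd_harmonic_ge0 // ltW // central_gt0.
have p0 : 0 < 2 * n%:R + 1 :> R by rewrite ltr_wpDl // mulr_ge0.
rewrite -(ler_pM2r (exprn_gt0 2 p0)).
have -> : (central_weight n * O n) ^+ 6 * (2 * n%:R + 1) * (2 * n%:R + 1) ^+ 2 =
    (central_weight n ^+ 2 * (2 * n%:R + 1)) ^+ 3 * (O n ^+ 3) ^+ 2 by ring.
rewrite -exprMn -[leRHS]mul1r; apply: ler_pM.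
- by rewrite exprn_ge0 // mulr_ge0 ?sqr_ge0 // ltW.
- by rewrite sqr_ge0.
- by rewrite exprn_ile1 ?central_sqr_le // mulr_ge0 ?sqr_ge0 // ltW.
- by rewrite lerXn2r ?nnegrE ?exprn_ge0 ?odd_harmonic_ge0 ?odd_harmonic_cube_le //.
Qed.

(** * The weights of (i), (iv) and (v) *)

(** The parameter of (iv) is [m + 1] here, which encodes its positivity; at [m = 0] the binomial is
    1 and the weight is that of (i) and (v). *)
Definition bin_weight m k : R := C k / 2 ^+ (2 * k) / 'C(k + m.+1, m)%:R.

Lemma bin_weightS m k :
  bin_weight m k.+1 * (2 * (k%:R + m.+1%:R + 1)) = bin_weight m k * (2 * k%:R + 1).
Proof.
have k2 : k%:R + 2 != 0 :> R by rewrite -natrD pnatr_eq0 addn2.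
have p0 : 2 ^+ (2 * k) != 0 :> R by rewrite expf_neq0.
have b0 : 'C(k + m.+1, m)%:R != 0 :> R.
  by rewrite pnatr_eq0 -lt0n bin_gt0 addnS leqW // leq_addl.
have b1 : k%:R + m.+1%:R + 1 != 0 :> R by rewrite -natrD natr1 pnatr_eq0.
(* The factor [k + 2] cancels the denominator in [catalanS]. *)
have hb : (k%:R + 2) * 'C((k + m.+1).+1, m)%:R =
    (k%:R + m.+1%:R + 1) * 'C(k + m.+1, m)%:R :> R.
  have -> : k%:R + m.+1%:R + 1 = (k + m.+1).+1%:R :> R by rewrite -[RHS]natr1 natrD.
  rewrite -natrD -!natrM mul_bin_down; congr (_ * _)%:R.
  by rewrite addn2 addnS -!addSn addnK.
have -> : bin_weight m k.+1 = C k.+1 / 2 ^+ (2 * k.+1) /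
    ((k%:R + m.+1%:R + 1) * 'C(k + m.+1, m)%:R / (k%:R + 2)).
  by rewrite /bin_weight addSn -hb; congr (_ / _); field.
rewrite /bin_weight catalanS mulnS exprD.
move: 'C(_, _)%:R (m.+1%:R : R) b0 b1 => b x b0 b1.
by field; rewrite k2 p0 b0 b1.
Qed.

Lemma sum_bin_weight m n :
  \sum_(1 <= k < n.+1) bin_weight m k * O k = 2 / (2 * m.+1%:R - 1) ^+ 2
    - bin_weight m n * ((2 * n%:R + 1) * O n / (2 * m.+1%:R - 1)
                    + 2 * (n%:R + m.+1%:R) / (2 * m.+1%:R - 1) ^+ 2).
Proof.
have m0 := double_natr_sub1_neq0 m.+1.
rewrite (sum_odd_harmonic_rising m0) => [|k _]; last exact: bin_weightS.
have -> : bin_weight m 0 = m.+1%:R^-1.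
  by rewrite /bin_weight catalan0 muln0 expr0 add0n binSn !div1r invr1 mul1r.
have x0 : m.+1%:R != 0 :> R by rewrite pnatr_eq0.
congr (_ - _); move: (m.+1%:R : R) m0 x0 => x m0 x0.
by field; rewrite m0 x0.
Qed.

(** The partial sums are the limit minus [r]. The denominators in [r] are at least 1 apart from the
    power of 4; dropping them bounds [r] by the null sequences above. *)
Lemma cvg_sum_bin_weight m :
  series (fun k => bin_weight m k * O k) @ \oo --> (2 / (2 * m.+1%:R - 1) ^+ 2 : R).
Proof.
have bin_ge1 k : 1 <= 'C(k + m.+1, m)%:R :> R.
  by rewrite ler1n bin_gt0 addnS leqW // leq_addl.
set y := 2 * m.+1%:R - 1 : R.
set r : R^nat := fun n => bin_weight m n *
  ((2 * n%:R + 1) * O n / y + 2 * (n%:R + m.+1%:R) / y ^+ 2).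
suff r0 : r @ \oo --> (0 : R).
  have h : 2 / y ^+ 2 - r n @[n --> \oo] --> 2 / y ^+ 2 - 0.
    by apply: cvgB => //; exact: cvg_cst.
  (* [series] at [n + 1] sums over [k] from 0 to [n]; its [k = 0] term vanishes since [O 0 = 0]. *)
  rewrite subr0 in h; rewrite -cvg_shiftS; apply: cvg_trans h.
  apply: near_eq_cvg; near=> n.
  by rewrite /series /= big_ltn // odd_harmonic0 mulr0 add0r sum_bin_weight.
have lim : 2 * (central_weight n * O n) + 2 * m.+1%:R * central_weight n
    @[n --> \oo] -->
    (2 * 0 + 2 * m.+1%:R * 0 : R).
  apply: cvgD; apply: cvgMl_tmp; first exact: cvg_central_odd_harmonic.
  exact: cvg_central.
rewrite !mulr0 addr0 in lim.
apply: (squeeze_cvgr _ (cvg_cst _) lim); near=> n.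
have O0 := odd_harmonic_ge0 n; have n0 : 0 <= n%:R :> R by [].
have x1 : 1 <= m.+1%:R :> R by rewrite ler1n.
have b0 : 0 < 'C(n + m.+1, m)%:R :> R by exact: lt_le_trans (bin_ge1 n).
have W0 : 0 <= C n / 2 ^+ (2 * n) by rewrite divr_ge0 ?exprn_ge0 // ltW // catalan_gt0.
have w0 : 0 <= bin_weight m n by rewrite /bin_weight divr_ge0 // ltW.
have wW : bin_weight m n <= C n / 2 ^+ (2 * n).
  by rewrite /bin_weight ler_pdivrMr // ler_peMr.
have y1 : 1 <= y by rewrite /y; lra.
have A0 : 0 <= (2 * n%:R + 1) * O n by rewrite mulr_ge0 // addr_ge0 // mulr_ge0.
have B0 : 0 <= 2 * (n%:R + m.+1%:R) :> R by lra.
have shrink (a b : R) : 0 <= a -> 1 <= b -> 0 <= a / b <= a.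
  move=> a0 b1; have b_gt0 : 0 < b by apply: lt_le_trans b1.
  by rewrite divr_ge0 ?(ltW b_gt0) ?ler_pdivrMr ?ler_peMr.
have /andP[A1 A2] := shrink _ _ A0 y1.
have /andP[B1 B2] := shrink _ _ B0 (exprn_ege1 2 y1).
apply/andP; split; first by rewrite mulr_ge0 // addr_ge0.
apply: (le_trans (ler_pM w0 (addr_ge0 A1 B1) wW (lerD A2 B2))).
(* What remains is [2n + 1 <= 2(n + 1)] and [n + x <= x(n + 1)] with [x = m + 1 >= 1]. *)
have -> : 2 * (central_weight n * O n) + 2 * m.+1%:R * central_weight n =
    C n / 2 ^+ (2 * n) *
    (2 * (n%:R + 1) * O n + 2 * m.+1%:R * (n%:R + 1)).
  by rewrite /central_weight; ring.
by rewrite ler_wpM2l // lerD //; [rewrite ler_wpM2r //; lra|nra].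
Unshelve. all: by end_near. Qed.

(** * Products of consecutive odd numbers *)

(** This is [2^n] times the rising factorial of [x + 1/2]; the values [x = k] and [x = -k] give the
    denominators of (iii). *)
Definition odd_prod n x : R := \prod_(1 <= j < n.+1) (2 * (n%:R - j%:R + x) + 1).

Lemma odd_prodE n x : odd_prod n x = \prod_(0 <= i < n) (2 * (i%:R + x) + 1).
Proof.
rewrite big_nat_rev /odd_prod big_add1 /= add0n.
apply: eq_big_nat => i /andP[_ lt_in]; congr (2 * (_ + _) + 1).
by rewrite natrB.
Qed.

Lemma odd_prodS n x : odd_prod n.+1 x = odd_prod n x * (2 * (n%:R + x) + 1).
Proof. by rewrite !odd_prodE big_nat_recr. Qed.

(** Both sides are [odd_prod n.+1 x], split at its first or at its last factor. *)
Lemma odd_prod_shift n x :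
  odd_prod n (x + 1) * (2 * x + 1) = odd_prod n x * (2 * (n%:R + x) + 1).
Proof.
rewrite -odd_prodS !odd_prodE big_nat_recl // add0r mulrC; congr (_ * _).
by apply: eq_bigr => i _; rewrite -natr1; ring.
Qed.

(** Read backwards, the factors at [x = -n] are the negatives of those at [x = 0]. *)
Lemma odd_prodN n : odd_prod n (- n%:R) = (-1) ^+ n * odd_prod n 0.
Proof.
rewrite odd_prodE big_nat_rev /= add0n odd_prodE.
rewrite -[in (-1) ^+ n](subn0 n) -prodr_const_nat -big_split /=.
apply: eq_big_nat => i /andP[_ lt_in].
by rewrite natrB // -natr1; ring.
Qed.

Lemma odd_prod_nat_neq0 n k : odd_prod n k%:R != 0.
Proof.
rewrite odd_prodE prodf_seq_neq0; apply/allP => i _ /=.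
by rewrite -natrD double_natr_add1_neq0.
Qed.

Lemma odd_prodN_neq0 n k : odd_prod n (- k%:R) != 0.
Proof.
rewrite odd_prodE prodf_seq_neq0; apply/allP => i _ /=.
have [le_ki|lt_ik] := leqP k i.
  by rewrite -natrB // double_natr_add1_neq0.
have -> : 2 * (i%:R - k%:R) + 1 = - (2 * (k - i)%:R - 1) :> R.
  by rewrite natrB 1?ltnW //; ring.
by rewrite oppr_eq0 double_natr_sub1_neq0.
Qed.

(** Each step from [j] to [j + 1] multiplies [C j * (j + 1)!] by [2(2j + 1)]. In (iii) this
    evaluates [C (2n)] and [C (n + 1)]. *)
Lemma catalan_odd_prod n k :
  C (n + k) * ((n + k).+1)`!%:R = 2 ^+ n * odd_prod n k%:R * (C k * (k.+1)`!%:R).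
Proof.
elim: n => [|n IHn]; first by rewrite odd_prodE big_geq // expr0 !mul1r.
rewrite addSn catalanS odd_prodS exprS factS natrM natrD.
transitivity (2 * (2 * (n%:R + k%:R) + 1) * (C (n + k) * (n + k).+1`!%:R)).
  rewrite -!natr1 natrD; field.
  by rewrite -!natrD pnatr_eq0 addn2.
by rewrite IHn; ring.
Qed.

(** * The three finite identities *)

Lemma sum_catalan_odd_harmonic n :
  \sum_(1 <= k < n.+1) C k * O k / 2 ^+ (2 * k)
    = 2 - C n / 2 ^+ (2 * n) * ((2 * n%:R + 1) * O n + 2 * n%:R + 2).
Proof.
rewrite (eq_bigr (fun k => bin_weight 0 k * O k)) => [|k _].
  rewrite sum_bin_weight /bin_weight bin0 divr1.
  have -> : 2 * 1 - 1 = 1 :> R by ring.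
  by rewrite expr1n !divr1; ring. 
by rewrite /bin_weight bin0 divr1 mulrAC.
Qed.

Lemma sum_binom_odd_harmonic n :
  \sum_(1 <= k < n.+1)
      (-1) ^+ (k - 1) * 2 ^+ (2 * k) * 'C(n + 1, k + 1)%:R * (O k / C k)
    = 2 * n%:R * (n%:R + 1) / (2 * n%:R - 1) ^+ 2.
Proof.
have n0 := double_natr_sub1_neq0 n.
(* The sign is [-(-1)^k] because the truncated [k - 1] would give the wrong sign at [k = 0], where
   the recurrence starts. *)
pose t k : R := - ((-1) ^+ k * 2 ^+ (2 * k) * 'C(n + 1, k + 1)%:R / C k).
rewrite (@eq_big_nat _ _ _ _ _ _ (fun k => t k * O k)) => [|[|k] // _]; last first.
  by rewrite /t subn1 /= exprS; ring.
rewrite (sum_odd_harmonic_falling n0) => [|k lt_kn].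
  (* Since [x = n], the upper boundary term vanishes and only [t 0] contributes. *)
  by rewrite subrr mulr0 mul0r subr0 /t catalan0 muln0 !expr0 add0n bin1 natrD; field.
have k2 : k%:R + 2 != 0 :> R by rewrite -natrD pnatr_eq0 addn2.
have k1 := double_natr_add1_neq0 k.
have C0 : C k != 0 by rewrite gt_eqF // catalan_gt0.
have hb : 'C(n + 1, k.+1 + 1)%:R =
    (n%:R - k%:R) * 'C(n + 1, k + 1)%:R / (k%:R + 2) :> R.
  apply: (mulIf k2); rewrite divfK // mulrC -natrD -natrB 1?ltnW //.
  by rewrite -!natrM !addn1 addn2 mul_bin_left subSS.
by rewrite /t hb catalanS mulnS exprD exprS; field; rewrite k2 k1 C0.
Qed.

(** With [x = n + 1], the boundary term [-A n (O n + 2/(2n + 1))] yields the last two terms on the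
    right, and [2 B n O (n + 1) / (2n + 1)] yields the first. *)
Lemma sum_catalan_odd_prod n :
  \sum_(1 <= k < n.+1)
      (2 ^- (2 * k) * C (n + k)%N / odd_prod n k%:R +
       2 ^+ (2 * k) * C (n - k)%N / odd_prod n (- k%:R)) * O k
    = (-1) ^+ n * 2 ^+ (3 * n + 2) / ((n + 2)`!)%:R * (O (n + 1)%N / C (n + 1)%N)
      - 2 ^- n * O n / (n`!%:R * (2 * n%:R + 1))
      - 2 ^ (1 - n%:Z) / (n`!%:R * (2 * n%:R + 1) ^+ 2).
Proof.
pose A k : R := 2 ^- (2 * k) * C (n + k)%N / odd_prod n k%:R.
pose B k : R := 2 ^+ (2 * k) * C (n - k)%N / odd_prod n (- k%:R).
have n0 := double_natr_add1_neq0 n.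
have p0 j : 2 ^+ j != 0 :> R by rewrite expf_neq0.
have f0 : n`!%:R != 0 :> R by rewrite pnatr_eq0 -lt0n fact_gt0.
have x0 : 2 * (n%:R + 1) - 1 != 0 :> R.
  by rewrite mulrDr -addrA (_ : 2 * 1 - 1 = 1) //; ring.
have AS k : A k.+1 * (2 * (k%:R + (n%:R + 1) + 1)) = A k * (2 * k%:R + 1).
  have k1 := double_natr_add1_neq0 k.
  have P0 := odd_prod_nat_neq0 n k.
  have nk1 := double_natr_add1_neq0 (n + k); rewrite natrD in nk1.
  have nk2 : n%:R + k%:R + 2 != 0 :> R by rewrite -!natrD pnatr_eq0 addn2.
  have hP : odd_prod n k.+1%:R =
      odd_prod n k%:R * (2 * (n%:R + k%:R) + 1) / (2 * k%:R + 1).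
    by rewrite -odd_prod_shift natr1 mulfK.
  rewrite /A hP addnS catalanS mulnS exprD natrD; field.
  by rewrite k1 P0 nk1 nk2 p0.
(* The bound on [k] keeps the truncated [n - k] an honest difference. *)
have BS k : (k < n)%N -> B k.+1 * (2 * k%:R + 1) = B k * (2 * (k%:R - (n%:R + 1))).
  move=> lt_kn.
  have k1 := double_natr_add1_neq0 k.
  have P0 := odd_prodN_neq0 n k.
  have P1 := odd_prodN_neq0 n k.+1.
  have ek : (n - k)%N = (n - k.+1).+1 by rewrite subnSK.
  have nk1 := double_natr_add1_neq0 (n - k.+1).
  have nk2 : (n - k.+1)%:R + 2 != 0 :> R by rewrite -natrD pnatr_eq0 addn2.
  have en : (n - k.+1)%:R = n%:R - k%:R - 1 :> R.
    by rewrite natrB // -(natr1 k) opprD addrA.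
  have hP : odd_prod n (- k%:R) = - (odd_prod n (- k.+1%:R) *
      (2 * (n - k.+1)%:R + 1) / (2 * k%:R + 1)).
    have := odd_prod_shift n (- k.+1%:R).
    have -> : - k.+1%:R + 1 = - k%:R :> R by rewrite -(natr1 k); ring.
    have -> : 2 * - k.+1%:R + 1 = - (2 * k%:R + 1) :> R by rewrite -(natr1 k); ring.
    by rewrite -natrB // => <-; rewrite mulrN mulNr opprK mulfK.
  rewrite /B ek catalanS mulnS exprD hP.
  have -> : k%:R - (n%:R + 1) = - ((n - k.+1)%:R + 2) :> R by rewrite en; ring.
  move: (n - k.+1)%N%:R nk1 nk2 => y nk1 nk2.
  by field; rewrite k1 P1 nk1 nk2.
under eq_bigr => k _ do rewrite mulrDl -/(A k) -/(B k).
rewrite big_split /= (sum_odd_harmonic_rising x0) => [|k _]; last exact: AS.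
rewrite (sum_odd_harmonic_falling x0) => [|k]; last exact: BS.
have -> : A 0 = B 0 by rewrite /A /B muln0 expr0 invr1 addn0 subn0 oppr0.
have Q0 : odd_prod n 0 != 0 by exact: (odd_prod_nat_neq0 n 0).
have An : A n = 2 ^- n / (n`!%:R * (2 * n%:R + 1)).
  have g0 : (2 * n)`!%:R != 0 :> R by rewrite pnatr_eq0 -lt0n fact_gt0.
  have P0 := odd_prod_nat_neq0 n n.
  have := catalan_odd_prod n n; rewrite addnn -mul2n factS natrM => h.
  have g1 : (2 * n).+1%:R * (2 * n)`!%:R != 0 :> R by rewrite mulf_neq0 // pnatr_eq0.
  have hC : C n * n.+1`!%:R = (2 * n)`!%:R / n`!%:R by rewrite -catalan_fact mulfK.
  have e1 : (2 * n).+1%:R = 2 * n%:R + 1 :> R by rewrite -[LHS]natr1 natrM.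
  have e2 : 2 ^+ (2 * n) = 2 ^+ n * 2 ^+ n :> R by rewrite mul2n -addnn exprD.
  rewrite /A addnn -(mul2n n) -[C (2 * n)](mulfK g1) h hC e1 e2.
  by field; rewrite p0 n0 f0 P0 g0.
have Bn : B n = (-1) ^+ n * 2 ^+ (2 * n) / odd_prod n 0.
  rewrite /B subnn catalan0 odd_prodN mulr1.
  (* Splitting on parity moves the sign out of the denominator. *)
  by rewrite -[in LHS]signr_odd -[in RHS]signr_odd; case: (odd n); field.
have Cn : C (n + 1) = 2 * (2 * n%:R + 1) * 2 ^+ n * odd_prod n 0 / (n + 2)`!%:R.
  have h0 : (n + 2)`!%:R != 0 :> R by rewrite pnatr_eq0 -lt0n fact_gt0.
  apply: (mulIf h0); rewrite divfK //.
  have := catalan_odd_prod n.+1 0; rewrite odd_prodS catalan0 addn0 exprS factS => h.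
  by rewrite addn1 addn2 h mulr0n -[1`!]/1%N; ring.
rewrite An Bn Cn addn1 odd_harmonicS.
have g0 : (n + 2)`!%:R != 0 :> R by rewrite pnatr_eq0 -lt0n fact_gt0.
have -> : 2 * (n%:R + 1) - 1 = 2 * n%:R + 1 :> R by ring.
have -> : 2 ^ (1 - n%:Z) = 2 / 2 ^+ n :> R by rewrite expfzDr // expr1z exprnN.
have -> : 2 ^+ (3 * n + 2) = 4 * 2 ^+ n * 2 ^+ n * 2 ^+ n :> R.
  by rewrite exprD mulnC exprM; ring.
have -> : 2 ^+ (2 * n) = 2 ^+ n * 2 ^+ n :> R by rewrite mul2n -addnn exprD.
move: (B 0) ((-1) ^+ n) (2 ^+ n) (p0 n) n`!%:R f0 (n + 2)`!%:R g0.
move: (odd_prod n 0) Q0 (O n) n%:R n0 => Q Q0 o y n0 b e p pn0 f f0 g g0.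
by field; rewrite ?pn0 ?g0 ?f0 ?n0 ?Q0.
Qed.
End CatalanOddHarmonic.

Theorem corollary2 (R : realType) (n m : nat) (m_gt0 : (0 < m)%N) :
  let C := @catalan R in
  let O := @odd_harmonic R in
  [/\ \sum_(1 <= k < n.+1) C k * O k / 2 ^+ (2 * k)
        = 2 - C n / 2 ^+ (2 * n) * ((2 * n%:R + 1) * O n + 2 * n%:R + 2),
      \sum_(1 <= k < n.+1)
          (-1) ^+ (k - 1) * 2 ^+ (2 * k) * 'C(n + 1, k + 1)%:R * (O k / C k)
        = 2 * n%:R * (n%:R + 1) / (2 * n%:R - 1) ^+ 2,
      \sum_(1 <= k < n.+1)
          (2 ^- (2 * k) * C (n + k)%N /
             (\prod_(1 <= j < n.+1) (2 * (n%:R - j%:R + k%:R) + 1)) +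
           2 ^+ (2 * k) * C (n - k)%N /
             (\prod_(1 <= j < n.+1) (2 * (n%:R - j%:R - k%:R) + 1))) * O k
        = (-1) ^+ n * 2 ^+ (3 * n + 2) / ((n + 2)`!)%:R
            * (O (n + 1)%N / C (n + 1)%N)
          - 2 ^- n * O n / (n`!%:R * (2 * n%:R + 1))
          - 2 ^ (1 - n%:Z) / (n`!%:R * (2 * n%:R + 1) ^+ 2),
      series (fun k : nat =>
          2 ^- (2 * k) * (C k * O k / 'C(k + m, m - 1)%:R)) @ \oo -->
        1 / (m%:R * (m%:R + 1)) *
        \sum_(1 <= k < m.+1)
          (-1) ^+ (k - 1) * 2 ^+ (2 * k) * 'C(m + 1, k + 1)%:R * (O k / C k)
    & series (fun k : nat => C k * O k / 2 ^+ (2 * k)) @ \oo --> (2 : R)].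
Proof.
move=> C O; split.
- exact: sum_catalan_odd_harmonic.
- exact: sum_binom_odd_harmonic.
- exact: sum_catalan_odd_prod.
(* Identity (ii) at [n = m] turns the claimed limit into [2 / (2m - 1)^2]. *)
- rewrite sum_binom_odd_harmonic; case: m m_gt0 => // m _.
  have x0 : m.+1%:R != 0 :> R by rewrite pnatr_eq0.
  have x1 : m.+1%:R + 1 != 0 :> R by rewrite natr1 pnatr_eq0.
  have -> : 1 / (m.+1%:R * (m.+1%:R + 1)) *
      (2 * m.+1%:R * (m.+1%:R + 1) / (2 * m.+1%:R - 1) ^+ 2) =
      2 / (2 * m.+1%:R - 1) ^+ 2 :> R.
    have := double_natr_sub1_neq0 R m.+1.
    move: (m.+1%:R : R) x0 x1 => x x0 x1 y0.
    by field; rewrite x0 x1 y0.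
  rewrite (_ : (fun _ => _) = (fun k => bin_weight R m k * O k)).
    exact: cvg_sum_bin_weight.
  apply/funext => k; rewrite /bin_weight /C /O subn1 /=.
  by rewrite mulrA (mulrA (2 ^- _)) [2 ^- _ * _]mulrC [RHS]mulrAC.
- rewrite (_ : (fun _ => _) = (fun k => bin_weight R 0 k * O k)).
    have -> : 2 = 2 / (2 * 1%:R - 1) ^+ 2 :> R by field.
    exact: cvg_sum_bin_weight.
  by apply/funext => k; rewrite /bin_weight bin0 divr1 mulrAC.
Qed.
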